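(* Let $\phi_0,\phi_1$ be real numbers with $|\phi_0|\le\phi_1\le\pi$, the cases $|\phi_0|=\phi_1=\pi$ being excluded, and let $\delta=\phi_1-\phi_0$. Let $$\theta_{\max}=\max\{0,\ \pi/2+\phi_0\},\qquad A_{\max}=\delta+2\theta_{\max}\left(1+\sqrt{1+\delta/\theta_{\max}}\right).$$ Then the equation $g(A)=0$, where $g(A)=Y(2A,\delta-A,\phi_0)$, admits a unique solution for $A\in(0,A_{\max}]$. Moreover $h(A)>0$ where $g(A)=0$, with $h(A)=X(2A,\delta-A,\phi_0)$.
   Context: For real $a,b,c$, $$X(a,b,c)=\int_0^1\cos\left(\tfrac a2\tau^2+b\tau+c\right)d\tau,\qquad Y(a,b,c)=\int_0^1\sin\left(\tfrac a2\tau^2+b\tau+c\right)d\tau .$$ Convention: $\theta_{\max}\sqrt{1+\delta/\theta_{\max}}$ means $\sqrt{\theta_{\max}^2+\theta_{\max}\delta}$, so that $A_{\max}=\delta$ when $\theta_{\max}=0$.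
   Formalization: The case φ₀ = −φ₁ is additionally excluded: there g has no zero in (0, A_max], e.g. for φ₀ = φ₁ = 0 one has A_max = 2π and g(A) = −∫₀¹ sin(Aτ(1−τ))dτ < 0 on (0, 2π], so the stated existence fails. *)

(* Defs.v *)
From Stdlib Require Export Reals.
From Coquelicot Require Export Coquelicot.

Open Scope R_scope.

(* The integrands are continuous, so [RInt] is the Riemann integral. *)
Definition X (a b c : R) : R :=
  RInt (fun t => cos (a / 2 * t ^ 2 + b * t + c)) 0 1.

Definition Y (a b c : R) : R :=
  RInt (fun t => sin (a / 2 * t ^ 2 + b * t + c)) 0 1.

Definition delta (phi0 phi1 : R) : R := phi1 - phi0.

Definition theta_max (phi0 : R) : R := Rmax 0 (PI / 2 + phi0).

(* [theta_max * sqrt (1 + delta / theta_max)] is read as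
   [sqrt (theta_max ^ 2 + theta_max * delta)], which also covers
   [theta_max = 0]. *)
Definition A_max (phi0 phi1 : R) : R :=
  let d := delta phi0 phi1 in
  let th := theta_max phi0 in
  d + 2 * (th + sqrt (th ^ 2 + th * d)).

Definition g (phi0 phi1 A : R) : R :=
  Y (2 * A) (delta phi0 phi1 - A) phi0.

Definition h (phi0 phi1 A : R) : R :=
  X (2 * A) (delta phi0 phi1 - A) phi0.

(* Main.v *)
Require Import Defs.
From Stdlib Require Import Lra.

(* Write [d] for [delta] and [th A t = A t^2 + (d - A) t + phi0], a convex
   parabola running from [phi0] to [phi1].  [g] is positive at [A = 0] and
   negative at [A_max], and each zero is a strict down-crossing: [g >= 0]
   forces a negative derivative, of [g] or of [sqrt A * g].

   For [A <= d], folding the integral at [t = 1/2] gives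
   [g A = int_0^(1/2) 2 sin (al - A y) cos (d x) dx], with [y = 1/4 - x^2] and
   [al = (phi0 + phi1) / 2].  The weight [cos (d x)] has positive integral and
   changes sign at most once, so comparing the other factor with its value at
   the sign change gives the sign of the derivative, and that of [h].

   For [A >= d] the vertex of the parabola lies in [[0, 1]].  With [m] its
   minimum, [a = (A - d) / (2 sqrt A)], [b = (A + d) / (2 sqrt A)] and
   [C], [S] the primitives of [cos (u^2)], [sin (u^2)], one has
   [sqrt A * g A = cos m (S a + S b) + sin m (C a + C b)].  Only
   [- PI/2 <= m <= 0] matters, and there everything follows from [C > 0],
   [S > 0] and [cos m * sin (m + a^2) < 2 a C a]. *)

(** * Calculus tools *)

Lemma ex_RInt_everywhere_continuous (f : R -> R) (a b : R) :
  (forall x : R, continuous f x) -> ex_RInt f a b.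
Proof. intros H. apply (ex_RInt_continuous (V := R_CompleteNormedModule)). auto. Qed.

Ltac solve_continuous :=
  apply (ex_derive_continuous (K := R_AbsRing) (V := R_NormedModule));
  auto_derive; auto.

Ltac solve_ex_RInt :=
  apply ex_RInt_everywhere_continuous; intros ?; solve_continuous.

Lemma is_derive_lt (f df : R -> R) (a b : R) :
  a < b -> (forall t : R, a <= t <= b -> is_derive f t (df t)) ->
  (forall t : R, a < t < b -> 0 < df t) -> f a < f b.
Proof.
  intros Hab Hd Hp.
  destruct (MVT_cor2 f df a b Hab) as [c [E Hc]].
  - intros c Hc. apply is_derive_Reals. auto.
  - specialize (Hp c Hc). nra.
Qed.

Lemma is_derive_le (f df : R -> R) (a b : R) :
  a <= b -> (forall t : R, a <= t <= b -> is_derive f t (df t)) ->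
  (forall t : R, a < t < b -> 0 <= df t) -> f a <= f b.
Proof.
  intros [Hab | ->] Hd Hp; [ | lra].
  destruct (MVT_cor2 f df a b Hab) as [c [E Hc]].
  - intros c Hc. apply is_derive_Reals. auto.
  - specialize (Hp c Hc). nra.
Qed.

(* The maximum of [f] over [[a, b]] would be a nonnegative value attained to
   the right of [a], where the derivative is negative. *)
Lemma single_crossing (f df : R -> R) (a b : R) :
  a < b -> (forall t : R, a <= t <= b -> is_derive f t (df t)) ->
  (forall t : R, a <= t <= b -> 0 <= f t -> df t < 0) ->
  f a <= 0 -> f b < 0.
Proof.
  intros Hab Hd Hneg Ha.
  destruct (Rlt_or_le (f b) 0) as [|Hb]; [assumption|exfalso].
  assert (Hm : exists t, a < t <= b /\ 0 <= f t /\
                forall s, a <= s <= b -> f s <= f t).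
  { destruct (continuity_ab_maj f a b) as [t [Hmax Ht]]; [lra| |].
    - intros c Hc. apply derivable_continuous_pt. exists (df c).
      apply is_derive_Reals. auto.
    - destruct (Rlt_or_le a t) as [Hat|Hat].
      + exists t. repeat split; try tauto.
        apply Rle_trans with (1 := Hb). apply Hmax. lra.
      (* A maximum at [a] gives [f s <= f a <= 0 <= f b], so [b] attains it as well. *)
      + replace t with a in * by lra. exists b.
        repeat split; try lra. intros s Hs.
        specialize (Hmax s Hs). lra. }
  destruct Hm as [t [Ht [Hpos Hmax]]].
  assert (Hdt := Hneg t ltac:(lra) Hpos).
  assert (D := Hd t ltac:(lra)). apply is_derive_Reals in D.
  destruct (D (- df t) ltac:(lra)) as [eps He].
  set (k := Rmin (eps / 2) (t - a)).
  assert (Hk : 0 < k <= eps / 2 /\ k <= t - a).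
  { assert (Hp := cond_pos eps). unfold k.
    assert (H1 := Rmin_l (eps / 2) (t - a)). assert (H2 := Rmin_r (eps / 2) (t - a)).
    assert (0 < Rmin (eps / 2) (t - a)) by (apply Rmin_pos; lra). lra. }
  assert (Hp := cond_pos eps).
  (* The left difference quotient at [t] is nonnegative by maximality, yet close enough to [df t] to
     be negative. *)
  specialize (He (- k) ltac:(lra) ltac:(rewrite Rabs_Ropp, Rabs_pos_eq; lra)).
  apply Rabs_def2 in He. destruct He as [He _].
  assert (Hle := Hmax (t + - k) ltac:(lra)).
  replace ((f (t + - k) - f t) / - k) with ((f t - f (t + - k)) / k) in He by (field; lra).
  assert (0 <= (f t - f (t + - k)) / k) by (apply Rdiv_le_0_compat; lra).
  lra.
Qed.

Lemma cos_ge_quadratic (x : R) : 1 - x ^ 2 / 2 <= cos x.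
Proof.
  replace x with (2 * (x / 2)) at 2 by field. rewrite cos_2a_sin.
  assert (H : forall y, 0 < y -> Rabs (sin y) <= y).
  { intros y Hy. apply Rabs_le. split.
    - assert (H := sin_lt_x y Hy).
      destruct (Rle_or_lt y PI).
      + assert (0 <= sin y) by (apply sin_ge_0; lra). lra.
      + assert (HS := SIN_bound y). assert (HP := PI2_1). lra.
    - apply Rlt_le, sin_lt_x, Hy. }
  assert (Hs : sin (x / 2) ^ 2 <= (x / 2) ^ 2).
  { rewrite <- (pow2_abs (sin (x / 2))), <- (pow2_abs (x / 2)).
    apply pow_incr. split; [apply Rabs_pos|].
    destruct (Rtotal_order (x / 2) 0) as [Hx|[Hx|Hx]].
    - rewrite <- Rabs_Ropp, <- sin_neg, <- (Rabs_Ropp (x / 2)).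
      rewrite (Rabs_pos_eq (- (x / 2))) by lra. apply H. lra.
    - rewrite Hx, sin_0. lra.
    - rewrite (Rabs_pos_eq (x / 2)) by lra. apply H. lra. }
  nra.
Qed.

(** * Fresnel integrals and their lower bounds *)

Definition fresnel_cos (a : R) : R := RInt (fun u => cos (u ^ 2)) 0 a.
Definition fresnel_sin (a : R) : R := RInt (fun u => sin (u ^ 2)) 0 a.

Lemma is_derive_RInt_continuous (f : R -> R) (a x : R) :
  (forall t : R, continuous f t) -> is_derive (fun y => RInt f a y) x (f x).
Proof.
  intros H. apply (is_derive_RInt (V := R_NormedModule) f _ a x); [|apply H].
  apply filter_forall. intros y. apply (RInt_correct (V := R_CompleteNormedModule)).
  now apply ex_RInt_everywhere_continuous.
Qed.

Lemma is_derive_fresnel_cos (a : R) : is_derive fresnel_cos a (cos (a ^ 2)).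
Proof.
  apply (is_derive_RInt_continuous (fun u => cos (u ^ 2)) 0).
  intros t. solve_continuous.
Qed.

Lemma is_derive_fresnel_sin (a : R) : is_derive fresnel_sin a (sin (a ^ 2)).
Proof.
  apply (is_derive_RInt_continuous (fun u => sin (u ^ 2)) 0).
  intros t. solve_continuous.
Qed.

Lemma fresnel_cos_0 : fresnel_cos 0 = 0.
Proof. apply (RInt_point (V := R_CompleteNormedModule)). Qed.

Lemma fresnel_sin_0 : fresnel_sin 0 = 0.
Proof. apply (RInt_point (V := R_CompleteNormedModule)). Qed.

(** The difference of the two sides vanishes at [0] and has derivative [2 * fresnel_cos t], positive
    because [cos (u ^ 2) > 0] for [0 < u < t]. *)
Lemma fresnel_cos_small (a : R) :
  0 < a -> a ^ 2 <= PI / 2 -> sin (a ^ 2) < 2 * a * fresnel_cos a.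
Proof.
  intros Ha Hle.
  assert (Hpos : forall t, 0 < t <= a -> 0 < fresnel_cos t).
  { intros t Ht. rewrite <- fresnel_cos_0.
    apply (is_derive_lt _ (fun u => cos (u ^ 2))); [lra| |].
    - intros u _. apply is_derive_fresnel_cos.
    - intros u Hu. apply cos_gt_0; nra. }
  assert (H : 2 * 0 * fresnel_cos 0 - sin (0 ^ 2) < 2 * a * fresnel_cos a - sin (a ^ 2)).
  { apply (is_derive_lt (fun t => 2 * t * fresnel_cos t - sin (t ^ 2))
             (fun t => 2 * fresnel_cos t)); [assumption| |].
    - intros t _. assert (D := is_derive_fresnel_cos t).
      auto_derive; [now exists (cos (t ^ 2))|].
      replace (Derive (fun x => fresnel_cos x) t) with (cos (t ^ 2))
        by (symmetry; apply is_derive_unique; exact D).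
      simpl. ring.
    - intros t Ht. assert (Hp := Hpos t ltac:(lra)). lra. }
  rewrite pow_i, sin_0 in H by auto. lra.
Qed.

(** Starting value for [fresnel_cos_large]. Integrating [cos (u ^ 2) >= 1 - u ^ 4 / 2] gives the
    lower bound [x - x ^ 3 / 10] with [x = PI / 2]. *)
Lemma fresnel_cos_sqrt_PI2 : 1 < sqrt (PI / 2) * fresnel_cos (sqrt (PI / 2)).
Proof.
  set (r := sqrt (PI / 2)).
  assert (Hr2 : r ^ 2 = PI / 2) by (apply pow2_sqrt; assert (H := PI_RGT_0); lra).
  assert (Hr : 0 < r) by (apply sqrt_lt_R0; assert (H := PI_RGT_0); lra).
  assert (H : fresnel_cos 0 - 0 + 0 ^ 5 / 10 <= fresnel_cos r - r + r ^ 5 / 10).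
  { apply (is_derive_le (fun t => fresnel_cos t - t + t ^ 5 / 10)
             (fun t => cos (t ^ 2) - 1 + t ^ 4 / 2)); [lra| |].
    - intros t _. assert (D := is_derive_fresnel_cos t).
      auto_derive; [now exists (cos (t ^ 2))|].
      replace (Derive (fun x => fresnel_cos x) t) with (cos (t ^ 2))
        by (symmetry; apply is_derive_unique; exact D).
      simpl. field.
    - intros t _. assert (Hc := cos_ge_quadratic (t ^ 2)). nra. }
  rewrite fresnel_cos_0 in H.
  assert (Hb : r * (r - r ^ 5 / 10) <= r * fresnel_cos r).
  { apply Rmult_le_compat_l; lra. }
  replace (r * (r - r ^ 5 / 10)) with (r ^ 2 - (r ^ 2) ^ 3 / 10) in Hb by (simpl; field).
  rewrite Hr2 in Hb. assert (H1 := PI2_3_2). assert (H2 := PI_4).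
  set (x := PI / 2) in *. assert (x <= 2) by (unfold x; lra).
  (* Expanded, this is [x ^ 3 <= 37/4 x - 21/2], the chord of the cube between [3/2] and [2]; it
     yields [x - x ^ 3 / 10 >= 3/40 x + 21/20 > 1]. *)
  assert (Hq : 0 <= (2 - x) * (x - 3 / 2) * (x + 7/2)).
  { repeat apply Rmult_le_pos; lra. }
  nra.
Qed.

(* [(2 a fresnel_cos a - sin (a ^ 2) - 1) / a] has derivative
   [(1 + sin (a ^ 2)) / a ^ 2]. *)
Lemma fresnel_cos_large (a : R) :
  PI / 2 <= a ^ 2 -> 0 < a -> 1 + sin (a ^ 2) < 2 * a * fresnel_cos a.
Proof.
  intros Hge Ha. set (r := sqrt (PI / 2)).
  assert (Hr2 : r ^ 2 = PI / 2) by (apply pow2_sqrt; assert (H := PI_RGT_0); lra).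
  assert (Hr : 0 < r) by (apply sqrt_lt_R0; assert (H := PI_RGT_0); lra).
  assert (Hra : r <= a) by (apply Rnot_lt_le; intros Hlt; nra).
  assert (H : 2 * fresnel_cos r - (sin (r ^ 2) + 1) / r
              <= 2 * fresnel_cos a - (sin (a ^ 2) + 1) / a).
  { apply (is_derive_le (fun t => 2 * fresnel_cos t - (sin (t ^ 2) + 1) / t)
             (fun t => (1 + sin (t ^ 2)) / t ^ 2)); [lra| |].
    - intros t Ht. assert (D := is_derive_fresnel_cos t).
      auto_derive; [split; [now exists (cos (t ^ 2))|]; split; [lra | auto]|].
      replace (Derive (fun x => fresnel_cos x) t) with (cos (t ^ 2))
        by (symmetry; apply is_derive_unique; exact D).
      simpl. field. lra.
    - intros t Ht. apply Rdiv_le_0_compat; [|nra].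
      assert (HS := SIN_bound (t ^ 2)). lra. }
  assert (H1 := fresnel_cos_sqrt_PI2). fold r in H1.
  rewrite Hr2, sin_PI2 in H.
  assert (0 < 2 * fresnel_cos r - (1 + 1) / r).
  { replace (2 * fresnel_cos r - (1 + 1) / r) with (2 * (r * fresnel_cos r - 1) / r) by (field; lra).
    apply Rdiv_lt_0_compat; lra. }
  assert (0 < a * (2 * fresnel_cos a - (sin (a ^ 2) + 1) / a)) by (apply Rmult_lt_0_compat; lra).
  replace (a * (2 * fresnel_cos a - (sin (a ^ 2) + 1) / a))
    with (2 * a * fresnel_cos a - (sin (a ^ 2) + 1)) in * by (field; lra).
  lra.
Qed.

Lemma fresnel_cos_pos (a : R) : 0 < a -> 0 < fresnel_cos a.
Proof.
  intros Ha. apply (Rmult_lt_reg_l (2 * a)); [lra|]. rewrite Rmult_0_r.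
  destruct (Rle_or_lt (a ^ 2) (PI / 2)) as [H|H].
  - apply Rle_lt_trans with (sin (a ^ 2)); [|now apply fresnel_cos_small].
    assert (HP := PI_RGT_0). apply sin_ge_0; nra.
  - assert (H1 := fresnel_cos_large a ltac:(lra) Ha).
    assert (HS := SIN_bound (a ^ 2)). lra.
Qed.

(* [(2 a fresnel_sin a + cos (a ^ 2) - 1) / a] has derivative
   [(1 - cos (a ^ 2)) / a ^ 2]. *)
Lemma fresnel_sin_pos (a : R) : 0 < a -> 0 < fresnel_sin a.
Proof.
  intros Ha.
  assert (Hsmall : forall t, 0 < t <= 1 -> 0 < fresnel_sin t).
  { intros t Ht. rewrite <- fresnel_sin_0.
    apply (is_derive_lt _ (fun u => sin (u ^ 2))); [lra| |].
    - intros u _. apply is_derive_fresnel_sin.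
    - intros u Hu. assert (HP := PI2_1). apply sin_gt_0; nra. }
  destruct (Rle_or_lt a 1) as [H1|H1]; [apply Hsmall; lra|].
  (* This makes the quotient positive at [1], from where it is nondecreasing. *)
  assert (HD : 2 * 0 * fresnel_sin 0 + cos (0 ^ 2) < 2 * 1 * fresnel_sin 1 + cos (1 ^ 2)).
  { apply (is_derive_lt (fun t => 2 * t * fresnel_sin t + cos (t ^ 2))
             (fun t => 2 * fresnel_sin t)); [lra| |].
    - intros t _. assert (D := is_derive_fresnel_sin t).
      auto_derive; [now exists (sin (t ^ 2))|].
      replace (Derive (fun x => fresnel_sin x) t) with (sin (t ^ 2))
        by (symmetry; apply is_derive_unique; exact D).
      simpl. ring.
    - intros t Ht. assert (Hp := Hsmall t ltac:(lra)). lra. }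
  rewrite pow_i, cos_0 in HD by auto.
  assert (H : 2 * fresnel_sin 1 + (cos (1 ^ 2) - 1) / 1
              <= 2 * fresnel_sin a + (cos (a ^ 2) - 1) / a).
  { apply (is_derive_le (fun t => 2 * fresnel_sin t + (cos (t ^ 2) - 1) / t)
             (fun t => (1 - cos (t ^ 2)) / t ^ 2)); [lra| |].
    - intros t Ht. assert (D := is_derive_fresnel_sin t).
      auto_derive; [split; [now exists (sin (t ^ 2))|]; split; [lra | auto]|].
      replace (Derive (fun x => fresnel_sin x) t) with (sin (t ^ 2))
        by (symmetry; apply is_derive_unique; exact D).
      simpl. field. lra.
    - intros t Ht. apply Rdiv_le_0_compat; [|nra].
      assert (HS := COS_bound (t ^ 2)). lra. }
  assert (0 <= (1 - cos (a ^ 2)) / a).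
  { apply Rdiv_le_0_compat; [|lra]. assert (HS := COS_bound (a ^ 2)). lra. }
  replace ((cos (a ^ 2) - 1) / a) with (- ((1 - cos (a ^ 2)) / a)) in H by (field; lra).
  lra.
Qed.

(** The left side equals [sin (a ^ 2) + cos (m + a ^ 2) * sin m]. If [a ^ 2 <= PI / 2], the second
    term is nonpositive and [fresnel_cos_small] applies; otherwise it is at most [1] and
    [fresnel_cos_large] applies. *)
Lemma fresnel_cos_bound (a m : R) :
  0 < a -> - (PI / 2) <= m <= 0 -> m + a ^ 2 <= PI ->
  cos m * sin (m + a ^ 2) < 2 * a * fresnel_cos a.
Proof.
  intros Ha Hm Hle.
  assert (E : sin (a ^ 2) = sin (m + a ^ 2) * cos m - cos (m + a ^ 2) * sin m).
  { rewrite <- sin_minus. f_equal. ring. }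
  assert (Hsm : sin m <= 0).
  { replace m with (- (- m)) by ring. rewrite sin_neg.
    assert (HP := PI_RGT_0). assert (0 <= sin (- m)) by (apply sin_ge_0; lra). lra. }
  destruct (Rle_or_lt (a ^ 2) (PI / 2)) as [H|H].
  - apply Rle_lt_trans with (2 := fresnel_cos_small a Ha H).
    assert (0 <= cos (m + a ^ 2)) by (apply cos_ge_0; nra). nra.
  - assert (HL := fresnel_cos_large a ltac:(lra) Ha).
    assert (H1 := SIN_bound m). assert (H2 := COS_bound (m + a ^ 2)). nra.
Qed.

(** * Reduction of the integrals to Fresnel integrals *)

Lemma RInt_even_opp (f : R -> R) (a : R) :
  (forall x : R, continuous f x) -> (forall x : R, f (- x) = f x) ->
  RInt f 0 (- a) = - RInt f 0 a.
Proof.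
  intros Hf Heven.
  assert (H := RInt_comp_lin (V := R_CompleteNormedModule) f (-1) 0 0 a
                 (ex_RInt_everywhere_continuous f _ _ Hf)).
  rewrite Rmult_0_r, !Rplus_0_r in H.
  replace (-1 * a) with (- a) in H by ring. rewrite <- H.
  rewrite (RInt_ext _ (fun y => scal (-1) (f y))).
  - rewrite (RInt_scal (V := R_CompleteNormedModule))
      by now apply ex_RInt_everywhere_continuous.
    unfold scal; simpl; unfold mult; simpl. ring.
  - intros y _. f_equal. rewrite <- (Heven y). f_equal. ring.
Qed.

Lemma fresnel_cos_opp (a : R) : fresnel_cos (- a) = - fresnel_cos a.
Proof.
  apply (RInt_even_opp (fun u => cos (u ^ 2))); intros x; [solve_continuous|].
  f_equal. ring.
Qed.

Lemma fresnel_sin_opp (a : R) : fresnel_sin (- a) = - fresnel_sin a.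
Proof.
  apply (RInt_even_opp (fun u => sin (u ^ 2))); intros x; [solve_continuous|].
  f_equal. ring.
Qed.

(* [e] is the square root of the paper's [A]; the parabola
   [A t ^ 2 + (d - A) t + phi] equals [(e t - shift d e) ^ 2 + low d phi e]. *)
Definition shift (d e : R) : R := (e - d / e) / 2.
Definition low (d phi e : R) : R := phi - shift d e ^ 2.

(** In the variable [u = e t - shift d e], the interval [[0, 1]] runs from [- shift d e] to
    [shift (- d) e]. The Fresnel integrals are odd, hence the sums. *)
Definition sin_form (d phi e : R) : R :=
  cos (low d phi e) * (fresnel_sin (shift d e) + fresnel_sin (shift (- d) e)) +
  sin (low d phi e) * (fresnel_cos (shift d e) + fresnel_cos (shift (- d) e)).

Definition cos_form (d phi e : R) : R :=
  cos (low d phi e) * (fresnel_cos (shift d e) + fresnel_cos (shift (- d) e)) -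
  sin (low d phi e) * (fresnel_sin (shift d e) + fresnel_sin (shift (- d) e)).

Lemma shift_sub (d e : R) : e <> 0 -> e - shift d e = shift (- d) e.
Proof. intros He. unfold shift. field. exact He. Qed.

Lemma parabola_shift (d phi e t : R) :
  e <> 0 ->
  2 * e ^ 2 / 2 * t ^ 2 + (d - e ^ 2) * t + phi = low d phi e + (e * t - shift d e) ^ 2.
Proof. intros He. unfold low, shift. field. exact He. Qed.

(** Completing the square and expanding the sine of a sum gives the explicit primitive [P]. *)
Lemma RInt_sin_parabola (d phi e : R) :
  0 < e -> e * Y (2 * e ^ 2) (d - e ^ 2) phi = sin_form d phi e.
Proof.
  intros He. unfold Y.
  set (a := shift d e). set (m := low d phi e).
  pose (P := fun t => (cos m * fresnel_sin (e * t - a) + sin m * fresnel_cos (e * t - a)) / e).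
  rewrite (is_RInt_unique _ 0 1 (P 1 - P 0)).
  - unfold P, sin_form. fold m a. rewrite <- shift_sub by lra. fold a.
    rewrite Rmult_1_r, Rmult_0_r, Rminus_0_l, fresnel_sin_opp, fresnel_cos_opp.
    field. lra.
  - apply (is_RInt_derive (V := R_CompleteNormedModule)); intros t _; [|solve_continuous].
    unfold P. assert (D1 := is_derive_fresnel_sin (e * t - a)).
    assert (D2 := is_derive_fresnel_cos (e * t - a)).
    auto_derive; [split; [eexists; exact D1 | split; [eexists; exact D2 | auto]]|].
    replace (Derive (fun x => fresnel_cos x) _) with (cos ((e * t - a) ^ 2))
      by (symmetry; apply is_derive_unique; exact D2).
    replace (Derive (fun x => fresnel_sin x) _) with (sin ((e * t - a) ^ 2))
      by (symmetry; apply is_derive_unique; exact D1).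
    rewrite parabola_shift, sin_plus by lra. fold a m. field. lra.
Qed.

Lemma RInt_cos_parabola (d phi e : R) :
  0 < e -> e * X (2 * e ^ 2) (d - e ^ 2) phi = cos_form d phi e.
Proof.
  intros He. unfold X.
  set (a := shift d e). set (m := low d phi e).
  pose (P := fun t => (cos m * fresnel_cos (e * t - a) - sin m * fresnel_sin (e * t - a)) / e).
  rewrite (is_RInt_unique _ 0 1 (P 1 - P 0)).
  - unfold P, cos_form. fold m a. rewrite <- shift_sub by lra. fold a.
    rewrite Rmult_1_r, Rmult_0_r, Rminus_0_l, fresnel_sin_opp, fresnel_cos_opp.
    field. lra.
  - apply (is_RInt_derive (V := R_CompleteNormedModule)); intros t _; [|solve_continuous].
    unfold P. assert (D1 := is_derive_fresnel_sin (e * t - a)).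
    assert (D2 := is_derive_fresnel_cos (e * t - a)).
    auto_derive; [split; [eexists; exact D2 | split; [eexists; exact D1 | auto]]|].
    replace (Derive (fun x => fresnel_cos x) _) with (cos ((e * t - a) ^ 2))
      by (symmetry; apply is_derive_unique; exact D2).
    replace (Derive (fun x => fresnel_sin x) _) with (sin ((e * t - a) ^ 2))
      by (symmetry; apply is_derive_unique; exact D1).
    rewrite parabola_shift, cos_plus by lra. fold a m. field. lra.
Qed.

(** * Derivative of [sin_form] and sign of [cos_form], for [A >= d] *)

Lemma is_derive_shift (d e : R) :
  0 < e -> is_derive (shift d) e (shift (- d) e / e).
Proof.
  intros He. unfold shift. auto_derive; [lra|]. field. lra.
Qed.

Lemma is_derive_low (d phi e : R) :
  0 < e -> is_derive (low d phi) e (- 2 * shift d e * shift (- d) e / e).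
Proof.
  intros He. unfold low. assert (D := is_derive_shift d e He).
  auto_derive; [eexists; exact D|].
  replace (Derive (fun x => shift d x) e) with (shift (- d) e / e)
    by (symmetry; apply is_derive_unique; exact D).
  field. lra.
Qed.

(** With [a = shift d e] and [b = shift (- d) e], one has [a' = b / e] and [b' = a / e].
    Differentiating the Fresnel terms leaves the sines of the two boundary angles, and
    differentiating [low] leaves [cos_form]. *)
Definition sin_form_deriv (d phi e : R) : R :=
  (shift (- d) e * sin phi + shift d e * sin (phi + d)
   - 2 * shift d e * shift (- d) e * cos_form d phi e) / e.

Lemma is_derive_sin_form (d phi e : R) :
  0 < e -> is_derive (sin_form d phi) e (sin_form_deriv d phi e).
Proof.
  intros He.
  assert (Ha := is_derive_shift d e He). assert (Hb := is_derive_shift (- d) e He).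
  assert (Hm := is_derive_low d phi e He). rewrite Ropp_involutive in Hb.
  assert (E0 : phi = low d phi e + shift d e ^ 2) by (unfold low; ring).
  assert (E1 : phi + d = low d phi e + shift (- d) e ^ 2)
    by (unfold low, shift; field; lra).
  apply (f_equal sin) in E0. apply (f_equal sin) in E1.
  unfold sin_form_deriv, cos_form. rewrite E0, E1. unfold sin_form.
  set (a := shift d) in *. set (b := shift (- d)) in *. set (m := low d phi) in *.
  clearbody a b m. clear E0 E1. rewrite !sin_plus.
  assert (D1 := is_derive_fresnel_sin (a e)). assert (D2 := is_derive_fresnel_cos (a e)).
  assert (D3 := is_derive_fresnel_sin (b e)). assert (D4 := is_derive_fresnel_cos (b e)).
  auto_derive.
  { repeat match goal with |- _ /\ _ => split end; try exact I; eexists; eassumption. }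
  repeat match goal with
  | H : is_derive ?f ?x ?l |- context [Derive ?f' ?x] =>
      replace (Derive f' x) with l by (symmetry; apply is_derive_unique; exact H)
  end.
  field. lra.
Qed.

(* Where [sin_form] is nonnegative, [cos m * cos_form] is at least
   [Cs a + Cs b], and [fresnel_cos_bound] applies to both [a] and [b]. *)
Lemma sin_form_deriv_neg (d phi e : R) :
  0 < e -> 0 <= d -> 0 <= shift d e -> (shift d e = 0 -> - PI < phi < 0) ->
  - (PI / 2) <= low d phi e <= 0 -> phi + d <= PI ->
  0 <= sin_form d phi e -> sin_form_deriv d phi e < 0.
Proof.
  intros He Hd Ha Ha0 Hm Hphi HF.
  assert (E0 : phi = low d phi e + shift d e ^ 2) by (unfold low; ring).
  assert (E1 : phi + d = low d phi e + shift (- d) e ^ 2)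
    by (unfold low, shift; field; lra).
  assert (Hab : shift (- d) e = shift d e + d / e) by (unfold shift; field; lra).
  assert (Hde : 0 <= d / e) by (apply Rdiv_le_0_compat; lra).
  assert (Hb : 0 < shift (- d) e).
  { rewrite <- shift_sub by lra.
    destruct (Req_dec (shift d e) 0) as [Hz|Hz]; [lra|].
    rewrite shift_sub by lra. lra. }
  unfold sin_form_deriv. apply Rdiv_neg_pos; [|exact He].
  unfold cos_form, sin_form in *.
  set (a := shift d e) in *. set (b := shift (- d) e) in *. set (m := low d phi e) in *.
  destruct Ha as [Ha|Ha].
  - assert (Ba := fresnel_cos_bound a m Ha Hm ltac:(lra)).
    assert (Bb := fresnel_cos_bound b m Hb Hm ltac:(lra)).
    rewrite <- E0 in Ba. rewrite <- E1 in Bb.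
    assert (Ca := fresnel_cos_pos a Ha). assert (Cb := fresnel_cos_pos b Hb).
    set (Cs := fresnel_cos a + fresnel_cos b) in *.
    set (Sn := fresnel_sin a + fresnel_sin b) in *.
    (* At [m = - PI / 2], [sin_form] would be [- Cs < 0]. *)
    assert (Hcos : 0 < cos m).
    { destruct (proj1 Hm) as [Hlt|Heq].
      - apply cos_gt_0; lra.
      - exfalso. rewrite <- Heq, cos_neg, cos_PI2, sin_neg, sin_PI2 in HF.
        unfold Cs in HF. lra. }
    assert (Hsin : sin m <= 0).
    { replace m with (- (- m)) by ring. rewrite sin_neg.
      assert (0 <= sin (- m)) by (apply sin_ge_0; lra). lra. }
    assert (Hsq := sin2_cos2 m). unfold Rsqr in Hsq.
    assert (HH : Cs <= cos m * (cos m * Cs - sin m * Sn)).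
    { assert (0 <= - sin m * (cos m * Sn + sin m * Cs)) by (apply Rmult_le_pos; lra).
      replace (cos m * (cos m * Cs - sin m * Sn)) with
        ((sin m * sin m + cos m * cos m) * Cs + - sin m * (cos m * Sn + sin m * Cs)) by ring.
      rewrite Hsq. lra. }
    set (H := cos m * Cs - sin m * Sn) in *.
    apply (Rmult_lt_reg_l (cos m)); [exact Hcos|].
    assert (H1 : b * (cos m * sin phi) < b * (2 * a * fresnel_cos a))
      by (apply Rmult_lt_compat_l; assumption).
    assert (H2 : a * (cos m * sin (phi + d)) < a * (2 * b * fresnel_cos b))
      by (apply Rmult_lt_compat_l; assumption).
    assert (H3 : 2 * a * b * Cs <= 2 * a * b * (cos m * H)).
    { apply Rmult_le_compat_l; [|exact HH]. assert (0 < a * b) by (apply Rmult_lt_0_compat; assumption). lra. }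
    unfold Cs in H3. lra.
  (* With the vertex at [t = 0], only [b * sin phi] is left in the numerator. *)
  - assert (Hp := Ha0 (eq_sym Ha)). rewrite <- Ha.
    assert (0 < sin (- phi)) by (apply sin_gt_0; lra). rewrite sin_neg in *. nra.
Qed.

(** At a zero of [sin_form], [cos m * cos_form] equals the sum of the two [fresnel_cos] values, and
    [cos m > 0]. *)
Lemma cos_form_pos (d phi e : R) :
  0 < e -> 0 <= d -> 0 <= shift d e -> - (PI / 2) <= low d phi e <= 0 ->
  sin_form d phi e = 0 -> 0 < cos_form d phi e.
Proof.
  intros He Hd Ha Hm HF.
  assert (Hb : 0 < shift (- d) e).
  { rewrite <- shift_sub by lra. assert (Hde : 0 <= d / e) by (apply Rdiv_le_0_compat; lra).
    unfold shift in *. lra. }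
  unfold cos_form, sin_form in *.
  set (a := shift d e) in *. set (b := shift (- d) e) in *. set (m := low d phi e) in *.
  assert (HC : 0 < fresnel_cos a + fresnel_cos b).
  { assert (Cb := fresnel_cos_pos b Hb). destruct Ha as [Ha|Ha].
    - assert (Ca := fresnel_cos_pos a Ha). lra.
    - rewrite <- Ha, fresnel_cos_0. lra. }
  set (Cs := fresnel_cos a + fresnel_cos b) in *.
  set (Sn := fresnel_sin a + fresnel_sin b) in *.
  assert (Hcos : 0 < cos m).
  { destruct (proj1 Hm) as [Hlt|Heq].
    - apply cos_gt_0; assert (HP := PI_RGT_0); lra.
    - exfalso. rewrite <- Heq, cos_neg, cos_PI2, sin_neg, sin_PI2 in HF. lra. }
  apply (Rmult_lt_reg_l (cos m)); [exact Hcos|].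
  assert (Hsq := sin2_cos2 m). unfold Rsqr in Hsq.
  replace (cos m * (cos m * Cs - sin m * Sn)) with
    ((sin m * sin m + cos m * cos m) * Cs - sin m * (cos m * Sn + sin m * Cs)) by ring.
  rewrite Hsq, HF. lra.
Qed.

(** * Folding at the midpoint, for [A <= d] *)

Lemma RInt_fold_half (f : R -> R) :
  (forall x : R, continuous f x) ->
  RInt f 0 1 = RInt (fun x => f (1 / 2 + x) + f (1 / 2 - x)) 0 (1 / 2).
Proof.
  intros Hf.
  assert (Hex : forall u v, ex_RInt f u v)
    by (intros; now apply ex_RInt_everywhere_continuous).
  assert (H1 := RInt_comp_lin (V := R_CompleteNormedModule) f 1 (1 / 2) 0 (1 / 2) (Hex _ _)).
  assert (H2 := RInt_comp_lin (V := R_CompleteNormedModule) f (-1) (1 / 2) 0 (1 / 2) (Hex _ _)).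
  assert (X1 := ex_RInt_comp_lin (V := R_NormedModule) f 1 (1 / 2) 0 (1 / 2) (Hex _ _)).
  assert (X2 := ex_RInt_comp_lin (V := R_NormedModule) f (-1) (1 / 2) 0 (1 / 2) (Hex _ _)).
  replace (1 * 0 + 1 / 2) with (1 / 2) in H1 by field.
  replace (1 * (1 / 2) + 1 / 2) with 1 in H1 by field.
  replace (-1 * 0 + 1 / 2) with (1 / 2) in H2 by field.
  replace (-1 * (1 / 2) + 1 / 2) with 0 in H2 by field.
  rewrite <- (RInt_Chasles (V := R_CompleteNormedModule) f 0 (1 / 2) 1) by apply Hex.
  rewrite <- (opp_RInt_swap (V := R_CompleteNormedModule) f) by apply Hex.
  rewrite <- H1, <- H2.
  rewrite plus_comm. change (plus ?a (opp ?b)) with (minus a b).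
  rewrite <- (RInt_minus (V := R_CompleteNormedModule)) by assumption.
  apply RInt_ext. intros x _.
  unfold minus, plus, opp, scal; simpl; unfold mult; simpl.
  replace (1 * x + 1 / 2) with (1 / 2 + x) by ring.
  replace (-1 * x + 1 / 2) with (1 / 2 - x) by ring. ring.
Qed.

(** The angles at [1/2 + x] and [1/2 - x] are [p + d x] and [p - d x] with a common [p], so their
    sines add up to [2 sin p cos (d x)]. *)
Lemma Y_fold (d phi A : R) :
  Y (2 * A) (d - A) phi =
  RInt (fun x => 2 * sin (phi + d / 2 - A * (1 / 4 - x ^ 2)) * cos (d * x)) 0 (1 / 2).
Proof.
  unfold Y. rewrite RInt_fold_half by (intros; solve_continuous).
  apply RInt_ext. intros x _.
  set (p := phi + d / 2 - A * (1 / 4 - x ^ 2)).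
  replace (2 * A / 2 * (1 / 2 + x) ^ 2 + (d - A) * (1 / 2 + x) + phi) with (p + d * x)
    by (unfold p; field).
  replace (2 * A / 2 * (1 / 2 - x) ^ 2 + (d - A) * (1 / 2 - x) + phi) with (p - d * x)
    by (unfold p; field).
  rewrite sin_plus, sin_minus. simpl. ring.
Qed.

Lemma X_fold (d phi A : R) :
  X (2 * A) (d - A) phi =
  RInt (fun x => 2 * cos (phi + d / 2 - A * (1 / 4 - x ^ 2)) * cos (d * x)) 0 (1 / 2).
Proof.
  unfold X. rewrite RInt_fold_half by (intros; solve_continuous).
  apply RInt_ext. intros x _.
  set (p := phi + d / 2 - A * (1 / 4 - x ^ 2)).
  replace (2 * A / 2 * (1 / 2 + x) ^ 2 + (d - A) * (1 / 2 + x) + phi) with (p + d * x)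
    by (unfold p; field).
  replace (2 * A / 2 * (1 / 2 - x) ^ 2 + (d - A) * (1 / 2 - x) + phi) with (p - d * x)
    by (unfold p; field).
  rewrite cos_plus, cos_minus. simpl. ring.
Qed.

Definition Y_fold_deriv (d phi A : R) : R :=
  - 2 * RInt (fun x => (1 / 4 - x ^ 2) * cos (phi + d / 2 - A * (1 / 4 - x ^ 2)) * cos (d * x))
          0 (1 / 2).

Lemma is_derive_Y (d phi A : R) :
  is_derive (fun A => Y (2 * A) (d - A) phi) A (Y_fold_deriv d phi A).
Proof.
  apply is_derive_ext with (1 := fun A => eq_sym (Y_fold d phi A)).
  set (f := fun A x => 2 * sin (phi + d / 2 - A * (1 / 4 - x ^ 2)) * cos (d * x)).
  set (df := fun A x => - 2 * ((1 / 4 - x ^ 2) * cos (phi + d / 2 - A * (1 / 4 - x ^ 2)) * cos (d * x))).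
  assert (D : forall u x, is_derive (fun A => f A x) u (df u x)).
  { intros u x. unfold f, df. auto_derive; [auto|]. 
    change (x * (x * 1)) with (x ^ 2). unfold Rminus. ring. }
  assert (E : Y_fold_deriv d phi A = RInt (fun x => Derive (fun u => f u x) A) 0 (1 / 2)).
  { unfold Y_fold_deriv.
    rewrite (RInt_ext (fun x => Derive (fun u => f u x) A) (df A))
      by (intros x _; apply is_derive_unique, D).
    unfold df. symmetry.
    apply (RInt_scal (V := R_CompleteNormedModule)
             (fun x => (1 / 4 - x ^ 2) * cos (phi + d / 2 - A * (1 / 4 - x ^ 2)) * cos (d * x))).
    solve_ex_RInt. }
  rewrite E. apply is_derive_RInt_param.
  - apply filter_forall. intros u t _. eexists. apply D.
  - intros t _. apply continuity_2d_pt_ext with (f := df).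
    + intros u v. symmetry. apply is_derive_unique, D.
    + unfold df.
      assert (Hy : continuity_2d_pt (fun _ v : R => 1 / 4 - v ^ 2) A t).
      { apply continuity_1d_2d_pt_comp with (f := fun v => 1 / 4 - v ^ 2);
          [|apply continuity_2d_pt_id2].
        reg. }
      apply continuity_2d_pt_mult; [apply continuity_2d_pt_const|].
      repeat apply continuity_2d_pt_mult; [exact Hy| |].
      * apply continuity_1d_2d_pt_comp with (f := cos); [apply continuity_cos|].
        apply continuity_2d_pt_minus; [apply continuity_2d_pt_const|].
        apply continuity_2d_pt_mult; [apply continuity_2d_pt_id1 | exact Hy].
      * apply continuity_1d_2d_pt_comp with (f := fun v => cos (d * v));
          [|apply continuity_2d_pt_id2].
        reg.
  - apply filter_forall. intros u. unfold f. solve_ex_RInt.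
Qed.

Lemma RInt_cos_half (d : R) : 0 < d -> RInt (fun x => cos (d * x)) 0 (1 / 2) = sin (d / 2) / d.
Proof.
  intros Hd. apply is_RInt_unique.
  replace (sin (d / 2) / d) with (minus (sin (d * (1 / 2)) / d) (sin (d * 0) / d)).
  - apply (is_RInt_derive (V := R_CompleteNormedModule) (fun x => sin (d * x) / d));
      intros x _; [|solve_continuous].
    auto_derive; [auto|]. field. lra.
  - unfold minus, plus, opp; simpl. rewrite Rmult_0_r, sin_0.
    replace (d * (1 / 2)) with (d / 2) by field. field. lra.
Qed.

Lemma cos_mul_sign (d x : R) :
  0 < d < 2 * PI -> 0 <= x <= 1 / 2 ->
  (x <= PI / (2 * d) -> 0 <= cos (d * x)) /\ (PI / (2 * d) <= x -> cos (d * x) <= 0).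
Proof.
  intros Hd Hx. split; intros H.
  - assert (H1 : d * x <= d * (PI / (2 * d))) by (apply Rmult_le_compat_l; lra).
    replace (d * (PI / (2 * d))) with (PI / 2) in H1 by (field; lra).
    assert (HP := PI_RGT_0). apply cos_ge_0; nra.
  - assert (H1 : d * (PI / (2 * d)) <= d * x) by (apply Rmult_le_compat_l; lra).
    replace (d * (PI / (2 * d))) with (PI / 2) in H1 by (field; lra).
    apply cos_le_0; nra.
Qed.

(* [cos (d * x)] changes sign on [[0, 1/2]] once, at [PI / (2 * d)], and has
   positive integral. *)
Lemma RInt_mul_cos_ge (f : R -> R) (d : R) :
  PI < d < 2 * PI -> (forall x : R, continuous f x) ->
  (forall x : R, 0 <= x <= PI / (2 * d) -> f (PI / (2 * d)) <= f x) ->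
  (forall x : R, PI / (2 * d) <= x <= 1 / 2 -> f x <= f (PI / (2 * d))) ->
  f (PI / (2 * d)) * (sin (d / 2) / d) <= RInt (fun x => f x * cos (d * x)) 0 (1 / 2).
Proof.
  intros Hd Hf H1 H2. assert (HP := PI_RGT_0). set (c := f (PI / (2 * d))) in *.
  rewrite <- RInt_cos_half by lra.
  assert (Hc : forall x, continuous (fun x => cos (d * x)) x) by (intros; solve_continuous).
  change (c * RInt (fun x => cos (d * x)) 0 (1 / 2))
    with (scal c (RInt (fun x => cos (d * x)) 0 (1 / 2))).
  rewrite <- (RInt_scal (V := R_CompleteNormedModule))
    by now apply ex_RInt_everywhere_continuous.
  apply RInt_le; [lra| | |].
  - apply ex_RInt_everywhere_continuous. intros x.
    apply (continuous_scal_r (V := R_NormedModule)), Hc.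
  - apply ex_RInt_everywhere_continuous. intros x.
    apply (continuous_mult (K := R_AbsRing)); auto.
  (* Pointwise [(f x - c) * cos (d * x) >= 0], both factors changing sign at [PI / (2 * d)]. *)
  - intros x Hx. unfold scal; simpl; unfold mult; simpl.
    destruct (cos_mul_sign d x ltac:(lra) ltac:(lra)) as [P N].
    destruct (Rle_or_lt x (PI / (2 * d))) as [Hl|Hl].
    + apply Rmult_le_compat_r; [now apply P | apply H1; lra].
    + specialize (H2 x ltac:(lra)). specialize (N ltac:(lra)). nra.
Qed.

(** For [d <= PI] the weight is positive inside the interval. For [d > PI] the bound of
    [RInt_mul_cos_ge] is positive, since [PI / (2 * d) < 1/2] and [d / 2 < PI]. *)
Lemma RInt_mul_cos_pos (f : R -> R) (d : R) :
  0 <= d < 2 * PI -> (forall x : R, continuous f x) ->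
  (forall x : R, 0 <= x < 1 / 2 -> 0 < f x) ->
  (PI < d -> forall x : R, 0 <= x <= PI / (2 * d) -> f (PI / (2 * d)) <= f x) ->
  (PI < d -> forall x : R, PI / (2 * d) <= x <= 1 / 2 -> f x <= f (PI / (2 * d))) ->
  0 < RInt (fun x => f x * cos (d * x)) 0 (1 / 2).
Proof.
  intros Hd Hf Hp H1 H2. assert (HP := PI_RGT_0).
  destruct (Rle_or_lt d PI) as [Hle|Hlt].
  - apply RInt_gt_0; [lra| |].
    + intros x Hx. apply Rmult_lt_0_compat; [apply Hp; lra|].
      apply cos_gt_0; nra.
    + intros x _. apply (continuous_mult (K := R_AbsRing)); [auto|solve_continuous].
  - apply Rlt_le_trans with (2 := RInt_mul_cos_ge f d ltac:(lra) Hf (H1 Hlt) (H2 Hlt)).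
    apply Rmult_lt_0_compat.
    + apply Hp. split; [apply Rdiv_le_0_compat; lra|].
      apply (Rmult_lt_reg_l (2 * d)); [lra|].
      replace (2 * d * (PI / (2 * d))) with PI by (field; lra). lra.
    + apply Rdiv_lt_0_compat; [|lra]. apply sin_gt_0; lra.
Qed.

Lemma RInt_linear (f g : R -> R) (u v a b : R) :
  (forall x : R, continuous f x) -> (forall x : R, continuous g x) ->
  RInt (fun x => u * f x + v * g x) a b = u * RInt f a b + v * RInt g a b.
Proof.
  intros Hf Hg. apply is_RInt_unique.
  apply (is_RInt_plus (V := R_NormedModule)); apply (is_RInt_scal (V := R_NormedModule));
    apply (RInt_correct (V := R_CompleteNormedModule));
    now apply ex_RInt_everywhere_continuous.
Qed.

(** The sine factor of the folded integral increases with [x], so comparison bounds [Y] above by a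
    positive multiple of its value at [PI / (2 * d)]. A negative angle there would make [Y]
    negative. *)
Lemma mean_angle_lower_bound (d phi A : R) :
  PI < d < 2 * PI -> 0 < A <= d -> 0 < phi + d / 2 < PI / 2 ->
  0 <= Y (2 * A) (d - A) phi ->
  A * (1 / 4 - (PI / (2 * d)) ^ 2) <= phi + d / 2.
Proof.
  intros Hd HA Hal HY. assert (HP := PI_RGT_0).
  set (f := fun x => - (2 * sin (phi + d / 2 - A * (1 / 4 - x ^ 2)))).
  assert (Hx : 0 <= PI / (2 * d)) by (apply Rdiv_le_0_compat; lra).
  assert (Hmono : forall x y, 0 <= x <= y -> y <= 1 / 2 -> f y <= f x).
  { intros x y Hxy Hy. unfold f.
    assert (0 <= A * x ^ 2 <= A * y ^ 2)
      by (split; [apply Rmult_le_pos | apply Rmult_le_compat_l]; nra).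
    assert (A * y ^ 2 <= A * (1 / 4)) by (apply Rmult_le_compat_l; nra).
    assert (sin (phi + d / 2 - A * (1 / 4 - x ^ 2)) <= sin (phi + d / 2 - A * (1 / 4 - y ^ 2)))
      by (apply sin_incr_1; lra).
    lra. }
  assert (Hle : PI / (2 * d) <= 1 / 2).
  { apply (Rmult_le_reg_l (2 * d)); [lra|].
    replace (2 * d * (PI / (2 * d))) with PI by (field; lra). lra. }
  assert (H := RInt_mul_cos_ge f d Hd ltac:(intros; unfold f; solve_continuous)
                 ltac:(intros; apply Hmono; lra) ltac:(intros; apply Hmono; lra)).
  rewrite Y_fold in HY.
  assert (E : RInt (fun x => f x * cos (d * x)) 0 (1 / 2) =
    - RInt (fun x => 2 * sin (phi + d / 2 - A * (1 / 4 - x ^ 2)) * cos (d * x)) 0 (1 / 2)).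
  { rewrite <- (RInt_opp (V := R_CompleteNormedModule)) by solve_ex_RInt.
    apply RInt_ext. intros x _. unfold f, opp; simpl. ring. }
  rewrite E in H. unfold f in H.
  assert (Hk : 0 < sin (d / 2) / d) by (apply Rdiv_lt_0_compat; [apply sin_gt_0|]; lra).
  set (ys := 1 / 4 - (PI / (2 * d)) ^ 2) in *.
  assert (0 <= ys <= 1 / 4) by (unfold ys; nra).
  assert (A * ys <= A * (1 / 4)) by (apply Rmult_le_compat_l; lra).
  apply Rnot_lt_le. intros Hlt.
  assert (Hs : sin (phi + d / 2 - A * ys) < 0) by (apply sin_lt_0_var; lra).
  nra.
Qed.

(** The factor compared is [y * cos (al - A y)] with [y = 1/4 - x ^ 2]. By [mean_angle_lower_bound],
    the angle [al - A * ys] at the sign change of the weight is nonnegative. *)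
Lemma Y_fold_deriv_neg (d phi A : R) :
  0 <= d < 2 * PI -> 0 < A <= d -> 0 < phi + d / 2 < PI / 2 ->
  0 <= Y (2 * A) (d - A) phi -> Y_fold_deriv d phi A < 0.
Proof.
  intros Hd HA Hal HY. assert (HP := PI_RGT_0). unfold Y_fold_deriv.
  set (f := fun x => (1 / 4 - x ^ 2) * cos (phi + d / 2 - A * (1 / 4 - x ^ 2))).
  assert (0 < RInt (fun x => f x * cos (d * x)) 0 (1 / 2)); [|unfold f in *; lra].
  apply RInt_mul_cos_pos; [assumption|intros; unfold f; solve_continuous| | |].
  - intros x Hx. unfold f. assert (0 < 1 / 4 - x ^ 2 <= 1 / 4) by nra.
    assert (0 < A * (1 / 4 - x ^ 2) <= A * (1 / 4))
      by (split; [apply Rmult_lt_0_compat | apply Rmult_le_compat_l]; lra).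
    apply Rmult_lt_0_compat; [lra|]. apply cos_gt_0; lra.
  - intros Hpd x Hx. assert (Hs := mean_angle_lower_bound d phi A ltac:(lra) HA Hal HY).
    unfold f. set (xs := PI / (2 * d)) in *.
    assert (Hxs : d * xs = PI / 2) by (unfold xs; field; lra).
    assert (Hxs2 : xs <= 1 / 2) by (apply (Rmult_le_reg_l d); lra).
    set (al := phi + d / 2) in *.
    assert (Hy : 1 / 4 - xs ^ 2 <= 1 / 4 - x ^ 2 <= 1 / 4) by nra.
    assert (Hys : 0 <= 1 / 4 - xs ^ 2) by nra.
    assert (Hdiff : 0 <= 1 / 4 - x ^ 2 - (1 / 4 - xs ^ 2) <= xs ^ 2) by nra.
    set (y := 1 / 4 - x ^ 2) in *. set (ys := 1 / 4 - xs ^ 2) in *.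
    assert (HAy : A * ys <= A * y <= A * (1 / 4))
      by (split; apply Rmult_le_compat_l; lra).
    assert (HAys : 0 <= A * ys) by (apply Rmult_le_pos; lra).
    destruct (Rle_or_lt (A * y) al) as [Hc|Hc].
    + apply Rmult_le_compat; [lra| |lra|].
      * apply cos_ge_0; lra.
      * apply cos_decr_1; lra.
    (* Here [al - A y] is negative and the cosine may decrease. Since
       [A ^ 2 * (y - ys) <= (d * xs) ^ 2 <= 4], it is at least [1 - 2 (y - ys)], and [y <= 1/4] lets
       the growth of [y] compensate the loss. *)
    + assert (H1 := COS_bound (al - A * ys)).
      assert (H2 := cos_ge_quadratic (al - A * y)).
      assert (H3 : (al - A * y) ^ 2 <= (A * (y - ys)) ^ 2).
      { replace ((al - A * y) ^ 2) with ((A * y - al) ^ 2) by ring.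
        apply pow_incr. lra. }
      assert (H4 : A ^ 2 * (y - ys) <= (d * xs) ^ 2).
      { rewrite Rpow_mult_distr. apply Rmult_le_compat; [nra|lra| |lra].
        apply pow_incr. lra. }
      assert (H5 : (d * xs) ^ 2 <= 4) by (rewrite Hxs; assert (H := PI_4); nra).
      assert (H6 : (A * (y - ys)) ^ 2 <= 4 * (y - ys)).
      { replace ((A * (y - ys)) ^ 2) with (A ^ 2 * (y - ys) * (y - ys)) by ring.
        apply Rmult_le_compat_r; lra. }
      assert (H7 : ys * cos (al - A * ys) <= ys) by nra.
      assert (H8 : y * (1 - 2 * (y - ys)) <= y * cos (al - A * y))
        by (apply Rmult_le_compat_l; lra).
      nra.
  (* Past the sign change [y <= ys], so [y] is smaller and the nonnegative angle larger: both
     factors decrease. *)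
  - intros Hpd x Hx. assert (Hs := mean_angle_lower_bound d phi A ltac:(lra) HA Hal HY).
    unfold f. set (xs := PI / (2 * d)) in *.
    assert (Hxs : 0 <= xs) by (apply Rdiv_le_0_compat; lra).
    set (al := phi + d / 2) in *.
    assert (Hy : 0 <= 1 / 4 - x ^ 2 <= 1 / 4 - xs ^ 2) by nra.
    assert (Hys : 1 / 4 - xs ^ 2 <= 1 / 4) by nra.
    set (y := 1 / 4 - x ^ 2) in *. set (ys := 1 / 4 - xs ^ 2) in *.
    assert (HAy : 0 <= A * y <= A * ys)
      by (split; [apply Rmult_le_pos | apply Rmult_le_compat_l]; lra).
    apply Rmult_le_compat; [lra| |lra|].
    + apply cos_ge_0; lra.
    + apply cos_decr_1; lra.
Qed.

(* With [al = phi + d / 2] the mean of the two boundary angles,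
   [sin al * X - cos al * Y] is the integral of [2 sin (A (1/4 - x^2)) cos (d x)]. *)
Lemma X_pos_below (d phi A : R) :
  0 <= d < 2 * PI -> 0 < A <= d -> 0 < phi + d / 2 < PI ->
  Y (2 * A) (d - A) phi = 0 -> 0 < X (2 * A) (d - A) phi.
Proof.
  intros Hd HA Hal HY. assert (HP := PI_RGT_0).
  assert (Hsin : 0 < sin (phi + d / 2)) by (apply sin_gt_0; lra).
  set (f := fun x => sin (A * (1 / 4 - x ^ 2))).
  assert (Hpos : 0 < RInt (fun x => f x * cos (d * x)) 0 (1 / 2)).
  { assert (Hmono : forall x y, 0 <= x <= y -> y <= 1 / 2 -> f y <= f x).
    { intros x y Hxy Hy. unfold f.
      assert (0 <= A * x ^ 2 <= A * y ^ 2)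
        by (split; [apply Rmult_le_pos | apply Rmult_le_compat_l]; nra).
      assert (A * y ^ 2 <= A * (1 / 4)) by (apply Rmult_le_compat_l; nra).
      apply sin_incr_1; lra. }
    apply RInt_mul_cos_pos; [assumption|intros; unfold f; solve_continuous| | |].
    - intros x Hx. unfold f. assert (0 < 1 / 4 - x ^ 2 <= 1 / 4) by nra.
      assert (0 < A * (1 / 4 - x ^ 2) <= A * (1 / 4))
        by (split; [apply Rmult_lt_0_compat | apply Rmult_le_compat_l]; lra).
      apply sin_gt_0; lra.
    - intros Hpd x Hx. apply Hmono; [lra|].
      apply (Rmult_le_reg_l (2 * d)); [lra|].
      replace (2 * d * (PI / (2 * d))) with PI by (field; lra). lra.
    - intros Hpd x Hx. assert (0 <= PI / (2 * d)) by (apply Rdiv_le_0_compat; lra).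
      apply Hmono; lra. }
  assert (E : 2 * RInt (fun x => f x * cos (d * x)) 0 (1 / 2)
    = sin (phi + d / 2) * X (2 * A) (d - A) phi
      + - cos (phi + d / 2) * Y (2 * A) (d - A) phi).
  { rewrite X_fold, Y_fold, <- RInt_linear by (intros; solve_continuous).
    change (2 * RInt (fun x => f x * cos (d * x)) 0 (1 / 2))
      with (scal 2 (RInt (fun x => f x * cos (d * x)) 0 (1 / 2))).
    rewrite <- (RInt_scal (V := R_CompleteNormedModule))
      by (unfold f; solve_ex_RInt).
    apply RInt_ext. intros x _. unfold f, scal; simpl; unfold mult; simpl.
    set (p := A * (1 / 4 - x * (x * 1))). set (al := phi + d / 2).
    replace p with (al - (al - p)) at 1 by ring. rewrite sin_minus. ring. }
  rewrite HY in E. nra.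
Qed.

(** * Crossings and boundary signs in terms of [A] *)

Lemma shift_le (d x y : R) : 0 <= d -> 0 < x <= y -> shift d x <= shift d y.
Proof.
  intros Hd Hxy. unfold shift.
  assert (d / y <= d / x).
  { apply Rmult_le_compat_l; [exact Hd|]. apply Rinv_le_contravar; lra. }
  lra.
Qed.

Lemma shift_sqrt (d A : R) : 0 < A -> shift d (sqrt A) = (A - d) / (2 * sqrt A).
Proof.
  intros HA. assert (Hs := sqrt_lt_R0 A HA). unfold shift.
  rewrite <- (pow2_sqrt A) at 3 by lra. field. lra.
Qed.

Lemma low_sqrt (d phi A : R) : 0 < A -> low d phi (sqrt A) = phi - (A - d) ^ 2 / (4 * A).
Proof.
  intros HA. assert (Hs := sqrt_lt_R0 A HA). unfold low. rewrite shift_sqrt by exact HA.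
  rewrite <- (pow2_sqrt A) at 4 by lra. field. lra.
Qed.

Lemma Y_sin_form (d phi A : R) :
  0 < A -> sqrt A * Y (2 * A) (d - A) phi = sin_form d phi (sqrt A).
Proof.
  intros HA. rewrite <- RInt_sin_parabola by now apply sqrt_lt_R0.
  now rewrite pow2_sqrt by lra.
Qed.

Lemma X_cos_form (d phi A : R) :
  0 < A -> sqrt A * X (2 * A) (d - A) phi = cos_form d phi (sqrt A).
Proof.
  intros HA. rewrite <- RInt_cos_parabola by now apply sqrt_lt_R0.
  now rewrite pow2_sqrt by lra.
Qed.

(** [single_crossing] applies to [sin_form] on [[sqrt A, sqrt B]]. There [shift d] is nonnegative
    and nondecreasing, so [low] is nonincreasing and its bounds at the two ends hold throughout. *)
Lemma Y_crossing_above (d phi A B : R) :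
  0 <= d -> - PI < phi -> phi + d <= PI -> 0 < A -> d <= A < B ->
  (d = A -> phi < 0) ->
  low d phi (sqrt A) <= 0 -> - (PI / 2) <= low d phi (sqrt B) ->
  Y (2 * A) (d - A) phi <= 0 -> Y (2 * B) (d - B) phi < 0.
Proof.
  intros Hd Hphi Hphi1 HA HAB HdA HlA HlB HY.
  assert (HsA := sqrt_lt_R0 A HA). assert (HsAB : sqrt A < sqrt B) by (apply sqrt_lt_1; lra).
  assert (HshA : 0 <= shift d (sqrt A)).
  { rewrite shift_sqrt by exact HA. apply Rdiv_le_0_compat; lra. }
  apply (Rmult_lt_reg_l (sqrt B)); [lra|]. rewrite Rmult_0_r, Y_sin_form by lra.
  apply (single_crossing (sin_form d phi) (sin_form_deriv d phi) (sqrt A)); [exact HsAB| | |].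
  - intros e He. apply is_derive_sin_form. lra.
  - intros e He. assert (H1 := shift_le d (sqrt A) e Hd ltac:(lra)).
    assert (H2 := shift_le d e (sqrt B) Hd ltac:(lra)).
    apply sin_form_deriv_neg; try lra.
    + intros Hz. assert (HAd : A = d).
      { rewrite shift_sqrt in HshA, H1 by exact HA.
        assert (Hq : (A - d) / (2 * sqrt A) = 0) by lra.
        apply (f_equal (fun t => t * (2 * sqrt A))) in Hq.
        replace ((A - d) / (2 * sqrt A) * (2 * sqrt A)) with (A - d) in Hq by (field; lra).
        lra. }
      assert (Hneg := HdA (eq_sym HAd)). lra.
    + unfold low in *. nra.
  - rewrite <- Y_sin_form by exact HA. nra.
Qed.

Lemma Y_crossing_below (d phi A B : R) :
  0 <= d < 2 * PI -> 0 < phi + d / 2 < PI / 2 -> 0 < A < B -> B <= d ->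
  Y (2 * A) (d - A) phi <= 0 -> Y (2 * B) (d - B) phi < 0.
Proof.
  intros Hd Hal HAB HB HY.
  apply (single_crossing (fun A => Y (2 * A) (d - A) phi) (Y_fold_deriv d phi) A); try lra.
  - intros t _. apply is_derive_Y.
  - intros t Ht Hge. apply Y_fold_deriv_neg; lra.
Qed.

(** The angle stays in [(0, PI)] inside the interval. The upper bound comes from the chord: the
    angle is [phi + d t - A t (1 - t)]. *)
Lemma Y_pos (d phi A : R) :
  0 < A -> 0 <= phi -> 0 <= d -> phi + d <= PI ->
  (A <= d \/ 0 < low d phi (sqrt A)) -> 0 < Y (2 * A) (d - A) phi.
Proof.
  intros HA Hphi Hd Hphi1 Hcase. unfold Y. apply RInt_gt_0; [lra| |intros; solve_continuous].
  intros t Ht. apply sin_gt_0.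
  - destruct Hcase as [H|H].
    + assert (0 <= (d - A) * t) by (apply Rmult_le_pos; lra).
      assert (0 < A * t ^ 2) by (apply Rmult_lt_0_compat; nra). lra.
    + assert (Hs := sqrt_lt_R0 A HA).
      rewrite <- (pow2_sqrt A) by lra. rewrite parabola_shift by lra.
      assert (H1 := pow2_ge_0 (sqrt A * t - shift d (sqrt A))). lra.
  - assert (0 < A * (t * (1 - t))) by (repeat apply Rmult_lt_0_compat; lra).
    assert (d * t <= d * 1) by (apply Rmult_le_compat_l; lra). nra.
Qed.

(** At [A = 0] the sine factor of the folded integral is a positive constant. *)
Lemma Y_0_pos (d phi : R) :
  0 <= d < 2 * PI -> 0 < phi + d / 2 < PI -> 0 < Y (2 * 0) (d - 0) phi.
Proof.
  intros Hd Hal. rewrite Y_fold.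
  apply (RInt_mul_cos_pos (fun x => 2 * sin (phi + d / 2 - 0 * (1 / 4 - x ^ 2))));
    [exact Hd|intros; solve_continuous| | |].
  - intros x _. rewrite Rmult_0_l, Rminus_0_r. apply Rmult_lt_0_compat; [lra|].
    apply sin_gt_0; lra.
  - intros _ x _. rewrite !Rmult_0_l. lra.
  - intros _ x _. rewrite !Rmult_0_l. lra.
Qed.

Lemma Y_neg_low_PI2 (d phi A : R) :
  0 <= d <= A -> 0 < A -> low d phi (sqrt A) = - (PI / 2) -> Y (2 * A) (d - A) phi < 0.
Proof.
  intros Hd HA Hlow. assert (Hs := sqrt_lt_R0 A HA).
  apply (Rmult_lt_reg_l (sqrt A)); [exact Hs|]. rewrite Rmult_0_r, Y_sin_form by exact HA.
  unfold sin_form. rewrite Hlow, cos_neg, cos_PI2, sin_neg, sin_PI2.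
  assert (Hb : 0 < fresnel_cos (shift (- d) (sqrt A))).
  { apply fresnel_cos_pos. rewrite shift_sqrt by exact HA. apply Rdiv_lt_0_compat; lra. }
  assert (Ha : 0 <= fresnel_cos (shift d (sqrt A))).
  { assert (H : 0 <= shift d (sqrt A))
      by (rewrite shift_sqrt by exact HA; apply Rdiv_le_0_compat; lra).
    destruct H as [H|<-]; [left; now apply fresnel_cos_pos | rewrite fresnel_cos_0; lra]. }
  lra.
Qed.

(** Covers the endpoint when [A_max = d]: the vertex is at [t = 0], so [m = phi], where the sine is
    negative and the cosine nonpositive. *)
Lemma Y_neg_vertex_start (d phi : R) :
  0 < d -> - PI < phi <= - (PI / 2) -> Y (2 * d) (d - d) phi < 0.
Proof.
  intros Hd Hphi. assert (Hs := sqrt_lt_R0 d Hd).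
  apply (Rmult_lt_reg_l (sqrt d)); [exact Hs|]. rewrite Rmult_0_r, Y_sin_form by exact Hd.
  unfold sin_form. rewrite low_sqrt, (shift_sqrt d) by exact Hd.
  replace ((d - d) / (2 * sqrt d)) with 0 by (field; lra).
  replace (phi - (d - d) ^ 2 / (4 * d)) with phi by (field; lra).
  assert (Hb : 0 < shift (- d) (sqrt d))
    by (rewrite shift_sqrt by exact Hd; apply Rdiv_lt_0_compat; lra).
  rewrite fresnel_cos_0, fresnel_sin_0.
  assert (HC := fresnel_cos_pos _ Hb). assert (HS := fresnel_sin_pos _ Hb).
  assert (Hsin : sin phi < 0) by (apply sin_lt_0_var; lra).
  assert (Hcos : cos phi <= 0) by (rewrite <- cos_neg; apply cos_le_0; lra).
  nra.
Qed.

(** The condition [(A - d) ^ 2 <= 4 A th] is quadratic in [A], with roots [d + 2 (th - s)] and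
    [d + 2 (th + s)]. The first is at most [d], the second is [A_max]. *)
Lemma low_ge_PI2 (phi0 phi1 A : R) :
  phi0 <= phi1 -> 0 < A -> delta phi0 phi1 <= A <= A_max phi0 phi1 ->
  - (PI / 2) <= phi0 -> - (PI / 2) <= low (delta phi0 phi1) phi0 (sqrt A).
Proof.
  intros Hle HA HAm Hphi. rewrite low_sqrt by exact HA.
  unfold A_max in HAm. set (d := delta phi0 phi1) in *.
  assert (Hd : 0 <= d) by (unfold d, delta; lra).
  unfold theta_max in HAm. rewrite Rmax_right in HAm by lra.
  set (th := PI / 2 + phi0) in *. assert (Hth : 0 <= th) by (unfold th; lra).
  assert (Hs2 : sqrt (th ^ 2 + th * d) ^ 2 = th ^ 2 + th * d) by (apply pow2_sqrt; nra).
  assert (Hs := sqrt_pos (th ^ 2 + th * d)).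
  set (s := sqrt (th ^ 2 + th * d)) in *.
  assert (th <= s) by (apply Rnot_lt_le; intros H; nra).
  assert ((A - d) ^ 2 / (4 * A) <= th); [|unfold th in *; lra].
  apply (Rmult_le_reg_r (4 * A)); [lra|].
  replace ((A - d) ^ 2 / (4 * A) * (4 * A)) with ((A - d) ^ 2) by (field; lra).
  assert (0 <= (2 * s - (A - d - 2 * th)) * (2 * s + (A - d - 2 * th)))
    by (apply Rmult_le_pos; lra).
  nra.
Qed.

Lemma low_A_max (phi0 phi1 : R) :
  phi0 <= phi1 -> - (PI / 2) < phi0 ->
  low (delta phi0 phi1) phi0 (sqrt (A_max phi0 phi1)) = - (PI / 2).
Proof.
  intros Hle Hphi. unfold A_max, theta_max. rewrite Rmax_right by lra.
  set (d := delta phi0 phi1). assert (Hd : 0 <= d) by (unfold d, delta; lra).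
  set (th := PI / 2 + phi0) in *. assert (Hth : 0 < th) by (unfold th; lra).
  assert (Hs2 : sqrt (th ^ 2 + th * d) ^ 2 = th ^ 2 + th * d) by (apply pow2_sqrt; nra).
  assert (Hs := sqrt_pos (th ^ 2 + th * d)).
  set (A := d + 2 * (th + sqrt (th ^ 2 + th * d))).
  assert (HA : 0 < A) by (unfold A; lra).
  rewrite low_sqrt by exact HA.
  assert ((A - d) ^ 2 / (4 * A) = th); [|unfold th in *; lra].
  apply (Rmult_eq_reg_r (4 * A)); [|lra].
  replace ((A - d) ^ 2 / (4 * A) * (4 * A)) with ((A - d) ^ 2) by (field; lra).
  unfold A. nra.
Qed.

(* The hypothesis [phi0 + phi1 <> 0] is necessary: for [phi0 = phi1 = 0], for
   instance, [g] is negative on the whole interval (0, A_max] and vanishes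
   only at the excluded endpoint [A = 0]. *)
Theorem theorem4p9 (phi0 phi1 : R)
    (Hphi : Rabs phi0 <= phi1 <= PI)
    (Hexcl : ~ (Rabs phi0 = phi1 /\ phi1 = PI))
    (Hne0 : phi0 + phi1 <> 0) :
  (exists! A : R, 0 < A <= A_max phi0 phi1 /\ g phi0 phi1 A = 0) /\
  (forall A : R, 0 < A <= A_max phi0 phi1 -> g phi0 phi1 A = 0 ->
     h phi0 phi1 A > 0).
Proof.
  assert (HP := PI_RGT_0).
  assert (H0 := Rle_abs phi0). assert (H0' := Rle_abs (- phi0)). rewrite Rabs_Ropp in H0'.
  assert (Hsum : 0 < phi0 + phi1) by lra.
  assert (Hsum2 : phi0 + phi1 < 2 * PI).
  { apply Rnot_le_lt. intros H. apply Hexcl. rewrite Rabs_pos_eq by lra. lra. }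
  unfold g, h.
  assert (Hlow := fun A => low_ge_PI2 phi0 phi1 A).
  assert (HlowM := low_A_max phi0 phi1 ltac:(lra)).
  assert (HthetaA : phi0 <= - (PI / 2) -> A_max phi0 phi1 = delta phi0 phi1).
  { intros H. unfold A_max, theta_max. rewrite Rmax_left by lra.
    replace (0 ^ 2 + 0 * delta phi0 phi1) with 0 by ring. rewrite sqrt_0. ring. }
  assert (HAmax : - (PI / 2) < phi0 -> delta phi0 phi1 < A_max phi0 phi1).
  { intros H. unfold A_max, theta_max. rewrite Rmax_right by lra.
    assert (Hs := sqrt_pos ((PI / 2 + phi0) ^ 2 + (PI / 2 + phi0) * delta phi0 phi1)). lra. }
  assert (Ed : delta phi0 phi1 = phi1 - phi0) by reflexivity.
  set (d := delta phi0 phi1) in *. set (M := A_max phi0 phi1) in *. clearbody d M.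
  assert (Hd : 0 <= d < 2 * PI) by lra.
  assert (HdM : d <= M) by (destruct (Rle_or_lt phi0 (- (PI / 2))); [rewrite HthetaA|left]; auto; lra).
  assert (HM : 0 < M) by (destruct (Rle_or_lt phi0 (- (PI / 2))); [rewrite HthetaA|]; auto; lra).
  (* A nonpositive value of [g] supplies the side conditions of the crossing lemmas, because [Y_pos]
     excludes their negations. *)
  assert (Habove : forall A, 0 < A <= M -> Y (2 * A) (d - A) phi0 <= 0 ->
            d <= A -> low d phi0 (sqrt A) <= 0 /\ (d = A -> phi0 < 0)).
  { intros A HA HY HdA. split.
    - destruct (Rle_or_lt 0 phi0) as [Hp|Hn].
      + apply Rnot_lt_le. intros Hl.
        assert (H := Y_pos d phi0 A ltac:(lra) Hp ltac:(lra) ltac:(lra) (or_intror Hl)). lra.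
      + unfold low. assert (H := pow2_ge_0 (shift d (sqrt A))). lra.
    - intros E. apply Rnot_le_lt. intros Hp.
      assert (H := Y_pos d phi0 A ltac:(lra) Hp ltac:(lra) ltac:(lra) ltac:(left; lra)). lra. }
  assert (Hbelow : forall A, 0 < A <= d -> Y (2 * A) (d - A) phi0 <= 0 -> phi0 < 0).
  { intros A HA HY. apply Rnot_le_lt. intros Hp.
    assert (H := Y_pos d phi0 A ltac:(lra) Hp ltac:(lra) ltac:(lra) ltac:(left; lra)). lra. }
  (* [d < M] forces [- PI / 2 < phi0], as otherwise [M = d]. *)
  assert (HlowM' : forall A, 0 < A <= M -> d < M -> d <= A -> - (PI / 2) <= low d phi0 (sqrt A)).
  { intros A HA Hlt HdA. apply Hlow; lra. }
  assert (Hcross : forall A B, 0 < A < B -> B <= M ->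
            Y (2 * A) (d - A) phi0 <= 0 -> Y (2 * B) (d - B) phi0 < 0).
  { intros A B HAB HB HY.
    assert (Hfirst : A < d -> forall B', A < B' <= d -> Y (2 * B') (d - B') phi0 < 0).
    (* From [phi0 < 0] and [phi1 <= PI], the mean angle [(phi0 + phi1) / 2] is below [PI / 2]. *)
    { intros HAd B' HB'. assert (Hn := Hbelow A ltac:(lra) HY).
      apply (Y_crossing_below d phi0 A); lra. }
    assert (Hsecond : forall A', 0 < A' -> d <= A' < B -> Y (2 * A') (d - A') phi0 <= 0 ->
              Y (2 * B) (d - B) phi0 < 0).
    { intros A' HA' HdA' HY'. destruct (Habove A' ltac:(lra) HY' ltac:(lra)) as [Hl Hz].
      apply (Y_crossing_above d phi0 A'); try lra.
      apply HlowM'; lra. }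
    destruct (Rlt_or_le A d) as [HAd|HAd]; [|apply (Hsecond A); lra].
    destruct (Rle_or_lt B d) as [HBd|HBd]; [apply Hfirst; lra|].
    (* When [A < d < B], the crossing is carried through [d]. *)
    apply (Hsecond d); [lra|lra|]. left. apply Hfirst; lra. }
  assert (Hend : Y (2 * M) (d - M) phi0 < 0).
  { destruct (Rle_or_lt phi0 (- (PI / 2))) as [H|H].
    - rewrite (HthetaA H). apply Y_neg_vertex_start; lra.
    - apply Y_neg_low_PI2; [lra|lra|auto]. }
  split.
  - assert (Hstart := Y_0_pos d phi0 Hd ltac:(lra)).
    (* [IVT] expects a change from negative to positive, hence the opposite of [g]. *)
    destruct (IVT (fun A => - Y (2 * A) (d - A) phi0) 0 M) as [A [HA HYA]]; try lra.
    { intros A. apply derivable_continuous_pt. exists (- Y_fold_deriv d phi0 A).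
      apply is_derive_Reals. apply (is_derive_opp (V := R_NormedModule)), is_derive_Y. }
    assert (HYA0 : Y (2 * A) (d - A) phi0 = 0) by lra.
    assert (HA0 : A <> 0) by (intros ->; lra).
    exists A. split; [split; [lra|exact HYA0]|].
    intros B [HB HYB].
    (* Of two distinct zeros, the smaller would make [g] negative at the larger. *)
    destruct (Rtotal_order A B) as [Hlt|[E|Hlt]]; [|exact E|]; exfalso.
    + assert (H := Hcross A B ltac:(lra) ltac:(lra) ltac:(lra)). lra.
    + assert (H := Hcross B A ltac:(lra) ltac:(lra) ltac:(lra)). lra.
  - intros A HA HY. destruct (Rlt_or_le d A) as [HdA|HdA].
    + destruct (Habove A HA ltac:(lra) ltac:(lra)) as [Hl _].
      assert (Hs := sqrt_lt_R0 A ltac:(lra)).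
      apply (Rmult_lt_reg_l (sqrt A)); [exact Hs|].
      rewrite Rmult_0_r, X_cos_form by lra. apply cos_form_pos; try lra.
      * rewrite shift_sqrt by lra. apply Rdiv_le_0_compat; lra.
      * split; [apply HlowM'; lra|exact Hl].
      * rewrite <- Y_sin_form, HY by lra. ring.
    + apply X_pos_below; lra.
Qed.
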